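(* Let $0<\varepsilon<1$. Assume $g\in C(\partial\Omega)$ is Lipschitz with constant $K$ with respect to the path metric $d$. Then the unique solution of the problem $$-\Delta_\infty^\varepsilon u=0\ \text{ in }\Omega,\qquad u=g\ \text{ on }\partial\Omega$$ is also Lipschitz with constant $K$ with respect to the path metric $d$.
   Context: $\Omega\subseteq\mathbb{R}^n$ is a bounded, connected, open set. For $x,y\in\bar\Omega$, $d(x,y)$ is the path distance: the infimum of the lengths of Lipschitz paths $\gamma:[0,1]\to\bar\Omega$ with $\gamma(0)=x$, $\gamma(1)=y$. It is assumed that $\operatorname{diam}(\Omega):=\sup\{d(x,y):x,y\in\bar\Omega\}<\infty$. Write $\bar\Omega(x,r):=\{y\in\bar\Omega: d(x,y)\le r\}$. For $\varepsilon>0$ set $\rho_\varepsilon(x,y):=\max\{d(x,y),\varepsilon\}$ if $x,y\in\Omega$, and $\rho_\varepsilon(x,y):=d(x,y)$ if $x\in\partial\Omega$ or $y\in\partial\Omega$. For $u:\bar\Omega\to\mathbb{R}$ and $x\in\Omega$, $$S^+_\varepsilon u(x):=\sup_{y\in\bar\Omega(x,\varepsilon)}\frac{u(y)-u(x)}{\rho_\varepsilon(x,y)},\quad S^-_\varepsilon u(x):=\sup_{y\in\bar\Omega(x,\varepsilon)}\frac{u(x)-u(y)}{\rho_\varepsilon(x,y)},\quad \Delta^\varepsilon_\infty u(x):=\frac1\varepsilon\big(S^+_\varepsilon u(x)-S^-_\varepsilon u(x)\big).$$ The equation is understood pointwise. The problem in the claim has a unique bounded solution $u:\bar\Omega\to\mathbb{R}$,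 and it belongs to $C(\bar\Omega)$. *)

(* Defs.v *)
From HB Require Import structures.
From mathcomp Require Import all_boot all_order all_algebra.
From mathcomp Require Import all_classical all_reals all_analysis.
Set Implicit Arguments.
Unset Strict Implicit.
Unset Printing Implicit Defensive.
Import Order.TTheory GRing.Theory Num.Theory.
Import numFieldNormedType.Exports.
Local Open Scope classical_set_scope.
Local Open Scope ring_scope.

(* The canonical norm on 'rV[R]_n is the sup norm: it has the same topology,
   bounded sets and Lipschitz maps as the Euclidean norm, but the lengths of
   curves differ, hence this definition. *)
Definition euclidean_norm (R : realType) (n : nat) (x : 'rV[R]_n) : R :=
  Num.sqrt (\sum_(i < n) x ord0 i ^+ 2).

Definition boundary (T : topologicalType) (A : set T) : set T :=
  closure A `\` interior A.

(* [itv_partition a b s] holds when a < s`_0 < ... < last = b. *)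
Definition curve_length (R : realType) (n : nat) (a b : R)
    (gamma : R -> 'rV[R]_n) : \bar R :=
  ereal_sup [set (\sum_(i < size s)
      euclidean_norm (gamma (nth b s i) - gamma (nth b (a :: s) i)))%:E
    | s in [set s | itv_partition a b s]].

Definition admissible_path (R : realType) (n : nat) (Omega : set 'rV[R]_n)
    (x y : 'rV[R]_n) (gamma : R -> 'rV[R]_n) : Prop :=
  [/\ [lipschitz gamma t | t in `[0%R, 1%R]],
      gamma @` `[0, 1] `<=` closure Omega,
      gamma 0 = x & gamma 1 = y].

(* Equal to +oo when no admissible path joins x to y. *)
Definition epath_dist (R : realType) (n : nat) (Omega : set 'rV[R]_n)
    (x y : 'rV[R]_n) : \bar R :=
  ereal_inf [set curve_length 0 1 gamma
    | gamma in [set gamma | admissible_path Omega x y gamma]].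

Definition path_diam (R : realType) (n : nat) (Omega : set 'rV[R]_n) : \bar R :=
  ereal_sup [set epath_dist Omega p.1 p.2
    | p in closure Omega `*` closure Omega].

(* Faithful on the closure of Omega as soon as [path_diam Omega < +oo]. *)
Definition path_dist (R : realType) (n : nat) (Omega : set 'rV[R]_n)
    (x y : 'rV[R]_n) : R :=
  fine (epath_dist Omega x y).

Definition path_ball (R : realType) (n : nat) (Omega : set 'rV[R]_n)
    (x : 'rV[R]_n) (r : R) : set 'rV[R]_n :=
  [set y | closure Omega y /\ path_dist Omega x y <= r].

Definition path_lipschitz (R : realType) (n : nat) (Omega A : set 'rV[R]_n)
    (K : R) (f : 'rV[R]_n -> R) : Prop :=
  forall x y, A x -> A y -> `|f x - f y| <= K * path_dist Omega x y.

Definition rho (R : realType) (n : nat) (Omega : set 'rV[R]_n) (eps : R)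
    (x y : 'rV[R]_n) : R :=
  if (x \in Omega) && (y \in Omega) then Num.max (path_dist Omega x y) eps
  else path_dist Omega x y.

(* The real-valued [sup] is the actual supremum here whenever u is bounded on
   the closure of the open set Omega and x is in Omega: [rho Omega eps x] is then
   bounded below by the smaller of eps and the distance of x to the boundary. *)
Definition slope_up (R : realType) (n : nat) (Omega : set 'rV[R]_n) (eps : R)
    (u : 'rV[R]_n -> R) (x : 'rV[R]_n) : R :=
  sup [set (u y - u x) / rho Omega eps x y | y in path_ball Omega x eps].

Definition slope_down (R : realType) (n : nat) (Omega : set 'rV[R]_n) (eps : R)
    (u : 'rV[R]_n -> R) (x : 'rV[R]_n) : R :=
  sup [set (u x - u y) / rho Omega eps x y | y in path_ball Omega x eps].

Definition infinity_laplacian (R : realType) (n : nat) (Omega : set 'rV[R]_n)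
    (eps : R) (u : 'rV[R]_n -> R) (x : 'rV[R]_n) : R :=
  eps^-1 * (slope_up Omega eps u x - slope_down Omega eps u x).

(* Functions on the closure of Omega are represented by total functions of
   which only the values on the closure matter. *)
Definition bounded_solution (R : realType) (n : nat) (Omega : set 'rV[R]_n)
    (eps : R) (g u : 'rV[R]_n -> R) : Prop :=
  [/\ [bounded u x | x in closure Omega],
      forall x, Omega x -> - infinity_laplacian Omega eps u x = 0 &
      forall x, boundary Omega x -> u x = g x].

(* Main.v *)
Require Import Defs.
From HB Require Import structures.
From mathcomp Require Import all_boot all_order all_algebra.
From mathcomp Require Import all_classical all_reals all_analysis.
From mathcomp Require Import ring lra.
Set Implicit Arguments.
Unset Strict Implicit.
Unset Printing Implicit Defensive.
Import Order.TTheory GRing.Theory Num.Theory.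
Import numFieldNormedType.Exports.
Local Open Scope classical_set_scope.
Local Open Scope ring_scope.

(** The equation says that at every [x] of [Omega] the largest upward and the
    largest downward slope within distance [eps] have a common value [S x].

    Inside [Omega] a step of size at most [eps] has length exactly [eps] for
    [rho], in both directions. So a step up from [x] to [z] of slope above [L]
    is, seen from [z], a step down of slope above [L], and [S z > L] again.
    Following such steps raises [u] by [L * eps] each time; as [u] is bounded,
    the walk reaches the boundary ([climb_to_boundary]). A walk up and a walk
    down from the same point join two boundary points between which [g] varies
    at a rate of at least [L]; hence [S <= K] ([slope_le]).

    The bound [S <= K] controls [u] only at scale [eps]. Since [d] is a length
    metric, cutting almost shortest paths into pieces of size [eps] yields the
    Lipschitz estimate when one of the two points lies on the boundary
    ([boundary_lipschitz]). For two interior points, suppose that the supremum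
    [M] of [gap u x y = u x - u y - K * d x y] is positive, and take a nearly
    maximal pair. Move [x] up along a nearly optimal step, and let [y] follow
    towards the new point along an almost shortest path ([coupled_move]). The
    distance does not grow, [u x] gains about [S x * eps] and [u y] at most
    [S y * eps], so the gap changes by at least about [(S x - S y) * eps].
    Maximality then forces [S x] and [S y] to be close
    ([near_maximal_slopes]), the new pair is again nearly maximal, and [S x]
    has hardly decreased. For a nearly maximal pair at distance at most [eps],
    [S x] is at least [M / (2 * eps)], so iterating the move pushes [u] above
    any bound ([common_slope_lipschitz]). Only approximate maxima are available,
    since none of the suprema need be attained.

    This argument takes place in an abstract length space; the rest consists in
    showing that [path_dist Omega] makes the closure of [Omega] such a space.
    The delicate property is the existence of almost intermediate points, read
    off a fine subdivision of an almost shortest path ([length_le_cut]). *)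

(** * Functions with equal upward and downward slopes on a length space *)

(** Instead of exact midpoints, [ls_split] asks for points at distance at most
    [r] from [x] that lie on an almost shortest way to [y]. *)
Record length_space (R : realType) (T : Type) (X : set T) (d : T -> T -> R) :
    Prop := LengthSpace {
  ls_refl : forall x, X x -> d x x = 0;
  ls_ge0 : forall x y, X x -> X y -> 0 <= d x y;
  ls_sym : forall x y, X x -> X y -> d x y = d y x;
  ls_tri : forall x y z, X x -> X y -> X z -> d x z <= d x y + d y z;
  ls_split : forall x y r eta, X x -> X y -> 0 <= r <= d x y -> 0 < eta ->
    exists z, [/\ X z, d x z <= r & d z y <= d x y - r + eta] }.

(** The value of [rho Omega eps x y] for [x] in [Omega] and [d x y <= eps]. *)
Definition tug_step (R : realType) (T : Type) (Om : set T) (d : T -> T -> R)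
    (eps : R) (x y : T) : R :=
  if y \in Om then eps else d x y.

(** [S] is at the same time the supremum of the upward and of the downward
    slopes of [u] at the points of [Om]. The formulation is invariant under
    [u := - u], so that every one-sided statement has a mirror image. *)
Record common_slope (R : realType) (T : Type) (X Om : set T) (d : T -> T -> R)
    (eps : R) (u S : T -> R) : Prop := CommonSlope {
  slope_bound : forall x y, Om x -> X y -> d x y <= eps ->
    `|u y - u x| <= S x * tug_step Om d eps x y;
  slope_up_attained : forall x L, Om x -> L < S x ->
    exists y, [/\ X y, d x y <= eps & L * tug_step Om d eps x y < u y - u x];
  slope_down_attained : forall x L, Om x -> L < S x ->
    exists y, [/\ X y, d x y <= eps & L * tug_step Om d eps x y < u x - u y] }.

Section tug.
Variables (R : realType) (T : Type) (X Om : set T) (d : T -> T -> R) (eps K : R).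
Hypotheses (lsX : length_space X d) (OmX : Om `<=` X) (eps_gt0 : 0 < eps).
Hypothesis sep : forall x y, Om x -> X y -> ~ Om y -> 0 < d x y.
Hypothesis K_ge0 : 0 <= K.

Local Notation step := (tug_step Om d eps).
Local Notation common_slope := (common_slope X Om d eps).

Lemma common_slopeN u S : common_slope u S -> common_slope (fun x => - u x) S.
Proof.
move=> [b p m]; split.
- by move=> x y Ox Xy xy; rewrite -opprD normrN; exact: b.
- move=> x L Ox LS; have [y [Xy xy h]] := m x L Ox LS.
  by exists y; split=> //; rewrite opprK addrC.
- move=> x L Ox LS; have [y [Xy xy h]] := p x L Ox LS.
  by exists y; split=> //; rewrite opprK addrC.
Qed.

Lemma step_in x y : Om y -> step x y = eps.
Proof. by move=> Oy; rewrite /tug_step; case: ifP => // /negP[]; rewrite inE. Qed.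

Lemma step_out x y : ~ Om y -> step x y = d x y.
Proof. by move=> Oy; rewrite /tug_step; case: ifP => //; rewrite inE. Qed.

Lemma dist_le_step x y : d x y <= eps -> d x y <= step x y.
Proof.
by move=> xy; have [Oy|Oy] := pselect (Om y); [rewrite step_in|rewrite step_out].
Qed.

Lemma step_le x y : d x y <= eps -> step x y <= eps.
Proof.
by move=> xy; have [Oy|Oy] := pselect (Om y); [rewrite step_in|rewrite step_out].
Qed.

Section solution.
Variables (u S : T -> R).
Hypothesis uS : common_slope u S.

Lemma slope_ge0 x : Om x -> 0 <= S x.
Proof.
move=> Ox; have := slope_bound uS Ox (OmX Ox).
rewrite (ls_refl lsX (OmX Ox)) subrr normr0 step_in// => /(_ (ltW eps_gt0)).
by rewrite pmulr_lge0.
Qed.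

(** A step up inside [Om] has length [eps] in both directions, so its slope
    is also a downward slope at its end point [y]: the strict bound [L < S y]
    is inherited, and the walk can only stop on the boundary. The number [k]
    bounds the steps left before [u] would exceed [B]. *)
Lemma climb_to_boundary (B L : R) : (forall x, X x -> u x <= B) -> 0 < L ->
  forall k x, Om x -> L < S x -> B - u x < k%:R * (L * eps) ->
  exists b, [/\ X b, ~ Om b & L * d x b <= u b - u x].
Proof.
move=> uB L_gt0; elim=> [|k IH] x Ox LS.
  by rewrite mul0r => h; have := uB x (OmX Ox); lra.
move=> h; have [y [Xy xy Ly]] := slope_up_attained uS Ox LS.
have [Oy|Oy] := pselect (Om y); last first.
  by exists y; split=> //; move: Ly; rewrite step_out// => /ltW.
rewrite step_in// in Ly.
have yx : d y x <= eps by rewrite (ls_sym lsX Xy (OmX Ox)).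
have LSy : L < S y.
  have := slope_bound uS Oy (OmX Ox) yx; rewrite step_in// => b.
  rewrite -(ltr_pM2r eps_gt0); apply: lt_le_trans Ly _; apply: le_trans b.
  by rewrite distrC ler_norm.
have [|b [Xb Ob hb]] := IH y Oy LSy.
  by move: h; rewrite -natr1 mulrDl mul1r; lra.
exists b; split=> //.
have := ls_tri lsX (OmX Ox) Xy Xb; rewrite -(ler_pM2l L_gt0) mulrDr.
by have : L * d x y <= L * eps; [rewrite ler_pM2l|lra].
Qed.

End solution.

(** If [S x] exceeded [K], the boundary points reached by walking up and
    down from [x] with a slope [L] strictly between would violate the
    Lipschitz bound; strictness uses that both are at positive distance. *)
Lemma slope_le u S B : common_slope u S -> (forall x, X x -> `|u x| <= B) ->
  (forall x y, X x -> ~ Om x -> X y -> ~ Om y -> `|u x - u y| <= K * d x y) ->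
  forall x, Om x -> S x <= K.
Proof.
move=> uS uB g_lip x Ox; rewrite leNgt; apply/negP => KS.
pose L := (K + S x) / 2; have KL : K < L by rewrite /L; lra.
have LS : L < S x by rewrite /L; lra.
have L_gt0 : 0 < L by exact: le_lt_trans KL.
have Leps : 0 < L * eps by rewrite mulr_gt0.
have fuel v : exists k, B - v < k%:R * (L * eps).
  exists (Num.truncn ((B - v) / (L * eps))).+1.
  by rewrite -ltr_pdivrMr// truncnS_gt.
have [k hk] := fuel (u x); have [k' hk'] := fuel (- u x).
have [|b [Xb Ob hb]] := climb_to_boundary uS _ L_gt0 Ox LS hk.
  by move=> y Xy; exact: le_trans (ler_norm _) (uB y Xy).
have [|c [Xc Oc hc]] := climb_to_boundary (common_slopeN uS) _ L_gt0 Ox LS hk'.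
  by move=> y Xy; apply: le_trans (ler_norm _) _; rewrite normrN; exact: uB.
have := le_trans (ler_norm _) (g_lip b c Xb Ob Xc Oc).
have tri := ls_tri lsX Xb (OmX Ox) Xc; rewrite (ls_sym lsX Xb (OmX Ox)) in tri.
have b_gt0 := sep Ox Xb Ob; have c_gt0 := sep Ox Xc Oc.
have : K * d b c <= K * (d x b + d x c) by rewrite ler_wpM2l.
have : K * (d x b + d x c) < L * (d x b + d x c) by rewrite ltr_pM2r ?addr_gt0.
rewrite [L * (_ + _)]mulrDr; lra.
Qed.

(** A point [y] of [Om] far from [p] can be moved by [eps] almost straight
    towards [p]; [u] changes by at most [K * eps], which is, up to an
    arbitrarily small error, the amount by which [K * d y p] drops. The
    constant [C] is [0] for the estimate at the boundary; positive values of
    [C] transfer a bound on the gap from close pairs to all pairs. *)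
Lemma local_to_global u S p C : common_slope u S ->
  (forall x, Om x -> S x <= K) -> X p ->
  (forall y, X y -> ~ Om y \/ d y p <= eps -> u y - u p <= K * d y p + C) ->
  forall y, X y -> u y - u p <= K * d y p + C.
Proof.
move=> uS SK Xp loc y Xy.
have [k] : exists k, d y p <= k%:R * (eps / 2).
  have e2 : 0 < eps / 2 by rewrite divr_gt0.
  exists (Num.truncn (d y p / (eps / 2))).+1.
  by rewrite -ler_pdivrMr// ltW// truncnS_gt.
elim: k y Xy => [|k IH] y Xy.
  by rewrite mul0r => yp; apply: loc => //; right; exact: le_trans yp (ltW _).
move=> ypk.
have [Oy|Oy] := pselect (Om y); last by apply: loc => //; left.
have [yp|yp] := leP (d y p) eps; first by apply: loc => //; right.
apply/ler_addgt0Pr => e e_gt0.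
have K1 : 0 < K + 1 by rewrite ltr_wpDl.
pose eta := Num.min (eps / 2) (e / (K + 1)).
have eta_gt0 : 0 < eta by rewrite lt_min !divr_gt0.
have eta_le : eta <= eps / 2 by rewrite ge_min lexx.
have Keta : K * eta <= e.
  have : (K + 1) * eta <= e by rewrite mulrC -ler_pdivlMr// ge_min lexx orbT.
  by rewrite mulrDl; lra.
have [|z [Xz yz zp]] := @ls_split _ _ _ _ lsX y p eps eta Xy Xp _ eta_gt0.
  by rewrite !ltW.
have uyz : u y - u z <= K * eps.
  apply: le_trans (ler_norm _) _; rewrite distrC.
  apply: le_trans (slope_bound uS Oy Xz yz) _.
  by apply: ler_pM (SK _ Oy) (step_le yz);
    rewrite ?(slope_ge0 uS)// (le_trans _ (dist_le_step yz))// (ls_ge0 lsX).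
have uzp : u z - u p <= K * d z p + C.
  have [Oz|Oz] := pselect (Om z); last by apply: loc => //; left.
  by apply: IH => //; move: ypk; rewrite -natr1 mulrDl mul1r; lra.
have : K * d z p <= K * (d y p - eps + eta) by rewrite ler_wpM2l.
rewrite mulrDr mulrBr; lra.
Qed.

(** For [p] on the boundary both exceptional cases of [local_to_global] are
    direct: [y] on the boundary is the hypothesis, and for [y] near [p] the
    step from [y] to [p] has length [d y p]. *)
Lemma boundary_lipschitz u S : common_slope u S ->
  (forall x, Om x -> S x <= K) ->
  (forall x y, X x -> ~ Om x -> X y -> ~ Om y -> `|u x - u y| <= K * d x y) ->
  forall y p, X y -> X p -> ~ Om p -> `|u y - u p| <= K * d y p.
Proof.
move=> uS SK g_lip.
have base v : common_slope v S ->
    (forall x y, X x -> ~ Om x -> X y -> ~ Om y -> `|v x - v y| <= K * d x y) ->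
    forall y p, X y -> X p -> ~ Om p -> v y - v p <= K * d y p.
  move=> vS v_lip y p Xy Xp Op; rewrite -[leRHS]addr0.
  apply: (local_to_global vS) => // {Xy}y Xy; rewrite addr0.
  have [Oy|Oy _] := pselect (Om y); last first.
    by apply: le_trans (ler_norm _) _; exact: v_lip.
  case=> [//|yp]; apply: le_trans (ler_norm _) _; rewrite distrC.
  apply: le_trans (slope_bound vS Oy Xp yp) _.
  by rewrite step_out// ler_wpM2r ?SK// (ls_ge0 lsX).
move=> y p Xy Xp Op; rewrite ler_norml; apply/andP; split; last exact: base.
rewrite lerNl; have := base _ (common_slopeN uS) _ y p Xy Xp Op.
rewrite /= opprD; apply=> x1 x2 X1 O1 X2 O2.
by rewrite -opprD normrN; exact: g_lip.
Qed.

Definition gap (u : T -> R) x y := u x - u y - K * d x y.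

Lemma gapN u x y : X x -> X y -> gap (fun z => - u z) x y = gap u y x.
Proof. by move=> Xx Xy; rewrite /gap opprK (ls_sym lsX Xx Xy) [- _ + _]addrC. Qed.

Definition no_boundary_gap (u : T -> R) :=
  forall x y, X x -> X y -> ~ Om x \/ ~ Om y -> gap u x y <= 0.

(** The point [z] is a nearly optimal step up from [x], and [w] lies at
    distance [eps] from [y] on an almost shortest way to [z]. The lower bound
    on the gap excludes the degenerate situations: [z] within [eps] of [y]
    would make the gap too small, and [z] or [w] on the boundary would
    contradict [no_boundary_gap]. With [t] the length of the step to
    [z], the inequality [S y <= K] absorbs the case [t < eps], in which [y]
    moves farther than [x]. *)
Lemma coupled_move u S x y delta : common_slope u S ->
  (forall x, Om x -> S x <= K) -> no_boundary_gap u ->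
  Om x -> Om y -> 0 < delta -> S y - delta <= S x ->
  (2 * eps + 1) * delta < gap u x y ->
  exists z w, [/\ Om z, Om w, S x - delta <= S z,
    (S x - delta) * eps <= u z - u x &
    gap u x y + (S x - S y) * eps - (eps + 1) * delta <= gap u z w].
Proof.
move=> uS SK bdry Ox Oy delta_gt0 Sxy gap_big.
have [Xx Xy] := (OmX Ox, OmX Oy).
have Sy_ge0 := slope_ge0 uS Oy; have SyK := SK _ Oy.
have dxy_ge0 := ls_ge0 lsX Xx Xy.
have [|z [Xz xz uxz]] := @slope_up_attained _ _ _ _ _ _ _ _ uS x (S x - delta) Ox.
  by lra.
set t := step x z in uxz.
have t_le : t <= eps := step_le xz.
have t_ge0 : 0 <= t := le_trans (ls_ge0 lsX Xx Xz) (dist_le_step xz).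
have yz_le : d y z <= d x y + t.
  apply: le_trans (ls_tri lsX Xy Xx Xz) _.
  by rewrite (ls_sym lsX Xy Xx) lerD2l; exact: dist_le_step.
have Ddelta : (S y - S x) * t <= delta * t by apply: ler_wpM2r => //; lra.
have t_delta : delta * t <= delta * eps by rewrite ler_pM2l.
(* When [z] is reachable from [y], the gap is at most [2 * eps * delta]. *)
have [yz|yz] := leP (d y z) eps.
  have uyz : u z - u y <= S y * (d x y + t).
    apply: le_trans (ler_norm _) (le_trans (slope_bound uS Oy Xz yz) _).
    apply: ler_wpM2l => //; have [Oz|Oz] := pselect (Om z); last by rewrite step_out.
    by rewrite /t !step_in// lerDr.
  have : S y * d x y <= K * d x y by rewrite ler_wpM2r.
  by exfalso; move: gap_big uxz uyz; rewrite /gap; nra.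
have K1 : 0 < K + 1 by lra.
pose eta := delta / (K + 1).
have eta_gt0 : 0 < eta by rewrite divr_gt0.
have Keta : K * eta <= delta.
  have : (K + 1) * eta = delta by rewrite mulrC divfK// gt_eqF.
  by rewrite mulrDl; lra.
have [|w [Xw yw wz]] := @ls_split _ _ _ _ lsX y z eps eta Xy Xz _ eta_gt0.
  by rewrite !ltW.
have uyw : u w - u y <= S y * eps.
  apply: le_trans (ler_norm _) (le_trans (slope_bound uS Oy Xw yw) _).
  by rewrite ler_wpM2l// step_le.
have Kzw : K * d z w <= K * (d x y + t - eps + eta).
  by rewrite (ls_sym lsX Xz Xw) ler_wpM2l//; lra.
have gap_zw : gap u x y + (S x - S y) * t - delta * t - delta <= gap u z w.
  have : (S y - K) * (eps - t) <= 0 by rewrite mulr_le0_ge0//; lra.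
  by move: uxz uyw Kzw Keta; rewrite /gap; nra.
have gap_gt0 : 0 < gap u z w by nra.
have Oz : Om z by apply: contrapT => Oz; have := bdry _ _ Xz Xw (or_introl Oz); lra.
have Ow : Om w by apply: contrapT => Ow; have := bdry _ _ Xz Xw (or_intror Ow); lra.
have tE : t = eps by exact: step_in.
exists z, w; split=> //; last by move: gap_zw; rewrite tE; nra.
- have zx : d z x <= eps by rewrite (ls_sym lsX Xz Xx).
  have := le_trans (ler_norm _) (slope_bound uS Oz Xx zx).
  have := slope_bound uS Oz Xx zx; rewrite distrC step_in// => /(le_trans (ler_norm _)).
  rewrite tE in uxz => uxz' _.
  by rewrite -(ler_pM2r eps_gt0); exact: le_trans (ltW uxz) uxz'.
- by rewrite -tE ltW.
Qed.

(** [coupled_move] raises the gap by [(S x - S y) * eps] up to an error, which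
    is impossible beyond [M]. The opposite inequality is the same statement
    for [- u] and the pair [(y, x)]. *)
Lemma near_maximal_slopes u S M x y delta : common_slope u S ->
  (forall x, Om x -> S x <= K) -> no_boundary_gap u ->
  (forall x y, Om x -> Om y -> gap u x y <= M) ->
  Om x -> Om y -> 0 < delta -> M - delta <= gap u x y ->
  (2 * eps + 1) * delta < gap u x y ->
  `|S x - S y| * eps <= (eps + 2) * delta.
Proof.
move=> uS SK bdry gapM Ox Oy delta_gt0 near big.
have half v x' y' : common_slope v S -> no_boundary_gap v ->
    (forall x y, Om x -> Om y -> gap v x y <= M) -> Om x' -> Om y' ->
    M - delta <= gap v x' y' -> (2 * eps + 1) * delta < gap v x' y' ->
    S y' <= S x' -> (S x' - S y') * eps <= (eps + 2) * delta.
  move=> vS bdryv gapv Ox' Oy' near' big' Sle.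
  have [|z [w [Oz Ow _ _]]] := coupled_move vS SK bdryv Ox' Oy' delta_gt0 _ big'.
    by lra.
  by have := gapv z w Oz Ow; lra.
have [Sle|/ltW Sle] := leP (S y) (S x).
  by rewrite ger0_norm ?subr_ge0//; exact: (half u).
rewrite distrC ger0_norm ?subr_ge0//.
apply: (half (fun z => - u z) y x) => //; rewrite ?gapN//; try exact: OmX.
- exact: common_slopeN.
- move=> p q Xp Xq O; rewrite gapN//; apply: bdry => //; case: O; tauto.
- by move=> p q Op Oq; rewrite gapN; [exact: gapM|exact: OmX|exact: OmX].
Qed.

(** In the proof, [start] finds nearly maximal pairs at distance at most
    [eps]: without them [local_to_global] would lower the supremum [M]. Then
    [chain] iterates [coupled_move]; the tolerance [delta] is arbitrary at each
    stage, so the errors of one move are paid for by starting from a better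
    pair. *)
Theorem common_slope_lipschitz u S B : common_slope u S ->
  (forall x, X x -> `|u x| <= B) ->
  (forall x y, X x -> ~ Om x -> X y -> ~ Om y -> `|u x - u y| <= K * d x y) ->
  forall x y, X x -> X y -> `|u x - u y| <= K * d x y.
Proof.
move=> uS uB g_lip.
have SK := slope_le uS uB g_lip.
have blip := boundary_lipschitz uS SK g_lip.
have bdry : no_boundary_gap u.
  move=> x y Xx Xy [Ox|Oy]; rewrite /gap subr_le0.
    by rewrite (ls_sym lsX Xx Xy); apply: le_trans (ler_norm _) _;
      rewrite distrC; exact: blip.
  by apply: le_trans (ler_norm _) _; exact: blip.
suff gap_le0 x y : X x -> X y -> gap u x y <= 0.
  move=> x y Xx Xy; rewrite ler_norml; apply/andP; split.
    by have := gap_le0 y x Xy Xx; rewrite /gap (ls_sym lsX Xx Xy); lra.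
  by have := gap_le0 x y Xx Xy; rewrite /gap; lra.
pose G := [set r | exists p q, [/\ X p, X q & r = gap u p q]].
have G_sup : X x -> X y -> has_sup G.
  move=> Xx Xy; split; first by exists (gap u x y), x, y.
  exists (B + B) => _ [p [q [Xp Xq ->]]].
  have := uB p Xp; have := uB q Xq; rewrite !ler_norml /gap.
  have : 0 <= K * d p q by rewrite mulr_ge0// (ls_ge0 lsX).
  lra.
move=> Xx Xy; have {}G_sup := G_sup Xx Xy.
pose M := sup G.
have gapM p q : X p -> X q -> gap u p q <= M.
  by move=> Xp Xq; apply: ub_le_sup; [exact: G_sup.2|exists p, q].
rewrite leNgt; apply/negP => gap_gt0.
have M_gt0 : 0 < M by exact: lt_le_trans (gapM _ _ Xx Xy).
have eps0 := eps_gt0.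
pose s := M / 2 / eps.
have s_gt0 : 0 < s by rewrite !divr_gt0.
have start delta : 0 < delta -> exists p q,
    [/\ Om p, Om q, M - delta <= gap u p q & s <= S p].
  move=> delta_gt0; pose m := Num.min delta (M / 2).
  have m_gt0 : 0 < m by rewrite lt_min delta_gt0 divr_gt0.
  have [m_delta m_M] : m <= delta /\ m <= M / 2 by rewrite !ge_min !lexx orbT.
  apply: contrapT => no_pair.
  suff : M <= M - m by lra.
  apply: ge_sup; first by exists (gap u x y), x, y.
  move=> _ [p [q [Xp Xq ->]]].
  rewrite /gap lerBlDl; apply: (local_to_global uS) => // {Xp}p Xp hp.
  rewrite -lerBlDl -/(gap u p q) leNgt; apply/negP => gapm.
  have [Op|Op] := pselect (Om p); last first.
    by have := bdry _ _ Xp Xq (or_introl Op); lra.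
  have [Oq|Oq] := pselect (Om q); last first.
    by have := bdry _ _ Xp Xq (or_intror Oq); lra.
  case: hp => // pq; apply: no_pair; exists p, q; split=> //; first by lra.
  rewrite /s ler_pdivrMr//.
  have := slope_bound uS Op Xq pq; rewrite step_in// distrC => /(le_trans (ler_norm _)).
  have : 0 <= K * d p q by rewrite mulr_ge0// (ls_ge0 lsX).
  by move: gapm; rewrite /gap; lra.
have chain k delta : 0 < delta -> exists p q,
    [/\ Om p, Om q, M - delta <= gap u p q, s - delta <= S p &
        k%:R * (s / 2 * eps) - B <= u p].
  elim: k delta => [|k IH] delta delta_gt0.
    have [p [q [Op Oq pq sp]]] := start _ delta_gt0.
    exists p, q; split=> //; first by lra.
    by have := uB p (OmX Op); rewrite ler_norml mul0r sub0r => /andP[].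
  pose m := Num.min delta (Num.min (M / 2) (s / 2)).
  have m_gt0 : 0 < m by rewrite !lt_min delta_gt0 !divr_gt0.
  have [m_delta m_M m_s] : [/\ m <= delta, m <= M / 2 & m <= s / 2].
    by rewrite !ge_min !lexx ?orbT.
  (* [a * d1] is the slope difference allowed by [near_maximal_slopes] for a
     pair within [d1] of the maximum; the move then loses at most
     [(2 * eps + 1) * (a * d1)], and [d1] makes the total loss equal to [m]. *)
  pose a := (eps + 2) / eps.
  have aE : a * eps = eps + 2 by rewrite divfK// gt_eqF.
  have a_gt1 : 1 < a by rewrite ltr_pdivlMr//; lra.
  have D_gt0 : 0 < 1 + (2 * eps + 1) * a by rewrite addr_gt0// mulr_gt0//; lra.
  pose d1 := m / (1 + (2 * eps + 1) * a).
  have d1_gt0 : 0 < d1 by rewrite divr_gt0.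
  have d1E : d1 + (2 * eps + 1) * (a * d1) = m.
    by rewrite mulrA -[X in X + _]mul1r -mulrDl mulrC divfK// gt_eqF.
  have ad1 : d1 <= a * d1 by rewrite ler_peMl// ltW.
  have a_gt0 : 0 < a by lra.
  have ead1 : 0 < eps * (a * d1) by apply: mulr_gt0 => //; exact: mulr_gt0.
  have [p [q [Op Oq pq sp up]]] := IH _ d1_gt0.
  have Spq : S q - a * d1 <= S p.
    have := near_maximal_slopes uS SK bdry
      (fun x y Ox Oy => gapM x y (OmX Ox) (OmX Oy)) Op Oq d1_gt0 pq.
    have e2 : (eps + 2) * d1 = a * d1 * eps by rewrite -aE; ring.
    rewrite e2 ler_pM2r// distrC => h.
    suff : S q - S p <= a * d1 by lra.
    apply: le_trans (ler_norm _) (h _).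
    apply: lt_le_trans pq.
    have : eps * d1 <= eps * (a * d1) by rewrite ler_pM2l.
    lra.
  have [||z [w [Oz Ow Sz uz gzw]]] := coupled_move uS SK bdry Op Oq _ Spq.
  - by rewrite mulr_gt0//; lra.
  - by lra.
  exists z, w; split=> //.
  - have : - (a * d1) * eps <= (S p - S q) * eps by rewrite ler_pM2r//; lra.
    by lra.
  - by lra.
  - rewrite -natr1 mulrDl mul1r.
    have : s / 2 * eps <= (S p - a * d1) * eps by rewrite ler_pM2r//; lra.
    lra.
have se_gt0 : 0 < s / 2 * eps by rewrite mulr_gt0// divr_gt0.
pose k := (Num.truncn ((B + B) / (s / 2 * eps))).+1.
have [p [q [Op _ _ _ up]]] := chain k 1 ltr01.
have : B + B < k%:R * (s / 2 * eps) by rewrite -ltr_pdivrMr// truncnS_gt.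
by have := uB p (OmX Op); rewrite ler_norml; lra.
Qed.

End tug.

(** * The Euclidean norm *)

Section euclidean_norm_theory.
Context {R : realType} {n : nat}.
Implicit Types x y : 'rV[R]_n.

Lemma euclidean_norm_ge0 x : 0 <= euclidean_norm x.
Proof. exact: sqrtr_ge0. Qed.

Lemma euclidean_norm0 : euclidean_norm (0 : 'rV[R]_n) = 0.
Proof.
by rewrite /euclidean_norm big1 ?sqrtr0// => i _; rewrite mxE expr0n.
Qed.

Lemma euclidean_normN x : euclidean_norm (- x) = euclidean_norm x.
Proof.
by rewrite /euclidean_norm; congr Num.sqrt; apply: eq_bigr => i _; rewrite mxE sqrrN.
Qed.

Lemma euclidean_distC x y : euclidean_norm (x - y) = euclidean_norm (y - x).
Proof. by rewrite -euclidean_normN opprB. Qed.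

Lemma sqr_euclidean_norm x : euclidean_norm x ^+ 2 = \sum_i x ord0 i ^+ 2.
Proof. by rewrite sqr_sqrtr// sumr_ge0// => i _; rewrite sqr_ge0. Qed.

Lemma le_coord_euclidean_norm x i : `|x ord0 i| <= euclidean_norm x.
Proof.
rewrite -sqrtr_sqr ler_wsqrtr// (bigD1 i)//= lerDl.
by rewrite sumr_ge0// => j _; rewrite sqr_ge0.
Qed.

Lemma cauchy_schwarz x y :
  \sum_i x ord0 i * y ord0 i <= euclidean_norm x * euclidean_norm y.
Proof.
set a := euclidean_norm x; set b := euclidean_norm y.
have [a_ge0 b_ge0] : 0 <= a /\ 0 <= b by rewrite !euclidean_norm_ge0.
have [ab_gt0|] := ltP 0 (a * b); last first.
  move=> ab_le0; have : a * b == 0 by rewrite eq_le ab_le0 mulr_ge0.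
  rewrite mulf_eq0 => ab0; rewrite big1 ?mulr_ge0// => i _.
  case/orP: ab0 => /eqP ab0; apply/eqP; rewrite mulf_eq0 -!normr_le0.
    by rewrite -ab0 le_coord_euclidean_norm.
  by rewrite -ab0 le_coord_euclidean_norm orbT.
have : 0 <= \sum_i (b * x ord0 i - a * y ord0 i) ^+ 2.
  by rewrite sumr_ge0// => i _; rewrite sqr_ge0.
have -> : \sum_i (b * x ord0 i - a * y ord0 i) ^+ 2 =
    \sum_i (b ^+ 2 * x ord0 i ^+ 2 + a ^+ 2 * y ord0 i ^+ 2 +
            - (2 * (a * b)) * (x ord0 i * y ord0 i)).
  by apply: eq_bigr => i _; ring.
rewrite !big_split/= -!mulr_sumr -!sqr_euclidean_norm -/a -/b => h.
rewrite -(ler_pM2l ab_gt0); set s := \sum_i _ in h *.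
have -> : a * b * s = (b ^+ 2 * a ^+ 2 + a ^+ 2 * b ^+ 2) / 2 -
    (b ^+ 2 * a ^+ 2 + a ^+ 2 * b ^+ 2 + - (2 * (a * b)) * s) / 2 by field.
have -> : a * b * (a * b) = (b ^+ 2 * a ^+ 2 + a ^+ 2 * b ^+ 2) / 2 by field.
by rewrite gerBl divr_ge0.
Qed.

Lemma ler_euclidean_normD x y :
  euclidean_norm (x + y) <= euclidean_norm x + euclidean_norm y.
Proof.
rewrite -(@ler_pXn2r _ 2) ?nnegrE ?addr_ge0 ?euclidean_norm_ge0//.
rewrite sqr_euclidean_norm sqrrD !sqr_euclidean_norm.
have -> : \sum_i (x + y) ord0 i ^+ 2 = \sum_i x ord0 i ^+ 2 +
    (\sum_i x ord0 i * y ord0 i) *+ 2 + \sum_i y ord0 i ^+ 2.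
  rewrite -sumrMnl -!big_split /=; apply: eq_bigr => i _.
  by rewrite mxE sqrrD.
by rewrite lerD2r lerD2l lerMn2r cauchy_schwarz orbT.
Qed.

Lemma euclidean_distD x y z : euclidean_norm (x - z) <=
  euclidean_norm (x - y) + euclidean_norm (y - z).
Proof. by rewrite -[x - z](subrKA y); exact: ler_euclidean_normD. Qed.

Lemma norm_le_euclidean_norm x : `|x| <= euclidean_norm x.
Proof.
rewrite -[`|x|]/(mx_norm x) mx_normrE bigmax_le ?euclidean_norm_ge0//.
by move=> -[i j] _; rewrite ord1; exact: le_coord_euclidean_norm.
Qed.

Lemma le_coord_norm x i : `|x ord0 i| <= `|x|.
Proof.
rewrite -[leRHS]/(mx_norm x) mx_normrE.
by apply: (le_bigmax _ (fun ij : 'I_1 * 'I_n => `|x ij.1 ij.2|) (ord0, i)).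
Qed.

Lemma euclidean_norm_le_norm x : euclidean_norm x <= Num.sqrt n%:R * `|x|.
Proof.
rewrite -[X in _ * X]ger0_norm// -sqrtr_sqr -sqrtrM// ler_wsqrtr//.
rewrite -[X in X%:R]card_ord mulr_natl -sumr_const ler_sum// => i _.
by rewrite -real_normK ?num_real// lerXn2r ?nnegrE// le_coord_norm.
Qed.

End euclidean_norm_theory.

(** * Polygonal lengths *)

Section polyline.
Context {R : realType} {n : nat}.
Implicit Types (f : R -> 'rV[R]_n) (a b c l : R) (s : seq R).

Fixpoint polyline f a s : R :=
  if s is b :: s' then euclidean_norm (f b - f a) + polyline f b s' else 0.

(** The recursive form of the sums that define [curve_length]; it is the one
    suited to induction on partitions. *)
Lemma polylineE f a b s :
  \sum_(i < size s) euclidean_norm (f (nth b s i) - f (nth b (a :: s) i)) =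
  polyline f a s.
Proof.
elim: s a => [|c s IH] a /=; first by rewrite big_ord0.
by rewrite big_ord_recl /= -IH.
Qed.

Lemma polyline_cat f a s1 s2 :
  polyline f a (s1 ++ s2) = polyline f a s1 + polyline f (last a s1) s2.
Proof. by elim: s1 a => [|c s1 IH] a /=; rewrite ?add0r// IH addrA. Qed.

Lemma polyline_comp f (phi : R -> R) a s :
  polyline (f \o phi) a s = polyline f (phi a) (map phi s).
Proof. by elim: s a => //= c s IH a; rewrite IH. Qed.

Lemma eq_polyline f g a s : {in a :: s, f =1 g} -> polyline f a s = polyline g a s.
Proof.
elim: s a => //= c s IH a fg; rewrite IH ?fg ?inE ?eqxx ?orbT// => t ts.
by apply: fg; rewrite inE ts orbT.
Qed.

Lemma last_rev_belast a s : last (last a s) (rev (belast a s)) = a.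
Proof. by case: s => //= c s; rewrite rev_cons last_rcons. Qed.

Lemma polyline_rev f a s :
  polyline f (last a s) (rev (belast a s)) = polyline f a s.
Proof.
elim: s a => //= c s IH a.
by rewrite rev_cons -cats1 polyline_cat IH last_rev_belast /= addr0 addrC
  euclidean_distC.
Qed.

Lemma itv_partition_mem a b s t : itv_partition a b s -> t \in a :: s -> a <= t <= b.
Proof.
elim: s a => [|c s IH] a.
  by move=> /itv_partition_nil->; rewrite inE => /eqP->; rewrite lexx.
move=> acs; have := acs.1 => /= /andP[ac _]; have cs := itv_partition_cons acs.
rewrite in_cons => /orP[/eqP->|/(IH _ cs)/andP[ct ->]].
  by rewrite lexx (itv_partition_le acs).
by rewrite (le_trans (ltW ac) ct).
Qed.

(** Inserting [c] in a partition only increases the polygonal length, by the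
    triangle inequality. The point [c] may be an end point, in which case one
    of the two partitions is empty. *)
Lemma itv_partition_split f a b c s : a <= c <= b -> itv_partition a b s ->
  exists s1 s2, [/\ itv_partition a c s1, itv_partition c b s2 &
    polyline f a s <= polyline f a s1 + polyline f c s2].
Proof.
elim: s a => [|h s IH] a acb.
  move=> /itv_partition_nil ab; have {acb ab}[<- <-] : a = c /\ a = b.
    by rewrite -ab in acb *; split=> //; apply/eqP; rewrite eq_le.
  by exists [::], [::]; split=> //=; rewrite addr0.
move=> ahs; have hs := itv_partition_cons ahs.
have ah : a < h by have := ahs.1 => /= /andP[].
have [->|ac] := eqVneq c a.
  by exists [::], (h :: s); split=> //=; rewrite add0r.
have {}ac : a < c by rewrite lt_neqAle eq_sym ac; case/andP: acb.
have cb : c <= b by case/andP: acb.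
have [hc|ch] := leP h c.
  have [|s1 [s2 [p1 p2 le]]] := IH h _ hs; first by rewrite hc.
  exists (h :: s1), s2; split=> //=; last by rewrite -addrA lerD2l.
  by case: p1 => p1 e1; split=> //=; rewrite ah.
exists [:: c], (h :: s); split=> /=.
- exact: itv_partition1.
- by case: hs => p e; split=> //=; rewrite ch.
- rewrite addr0 addrA lerD2r [leRHS]addrC; exact: euclidean_distD.
Qed.

(** A real upper bound on the length; quantifying over bounds avoids computing
    with extended real suprema. *)
Definition length_le f a b l :=
  forall s, itv_partition a b s -> polyline f a s <= l.

Lemma curve_length_le f a b l : (curve_length a b f <= l%:E)%E <-> length_le f a b l.
Proof.
split=> [fl s abs|fl].
  rewrite -lee_fin; apply: le_trans fl; apply: ereal_sup_ubound.
  by exists s => //; rewrite polylineE.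
by apply: ge_ereal_sup => _ [s abs <-]; rewrite polylineE lee_fin fl.
Qed.

Lemma length_le_eq f g a b l : (forall t, a <= t <= b -> f t = g t) ->
  length_le f a b l -> length_le g a b l.
Proof.
move=> fg fl s abs; rewrite -(@eq_polyline f); first exact: fl.
by move=> t ts; apply: fg; exact: itv_partition_mem ts.
Qed.

Lemma length_le_affine f a b l (p m : R) : 0 < m ->
  length_le f (p + m * a) (p + m * b) l ->
  length_le (fun t => f (p + m * t)) a b l.
Proof.
move=> m_gt0 fl s [abs /eqP bE].
rewrite -/(f \o (fun t => p + m * t)) (polyline_comp f); apply: fl; split.
  by apply: (homo_path (f := fun t => p + m * t)) abs => u v uv; rewrite ltrD2l ltr_pM2l.
by rewrite -bE; apply/eqP; exact: (last_map (fun t => p + m * t)).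
Qed.

Lemma length_le_rev f l : length_le f 0 1 l -> length_le (fun t => f (1 - t)) 0 1 l.
Proof.
move=> fl s [s01 /eqP s1]; pose phi (t : R) := 1 - t.
have last_phi : last (phi 0) (map phi s) = 0 by rewrite last_map s1 /phi subrr.
rewrite -[polyline _ _ _]/(polyline (f \o phi) 0 s) polyline_comp.
rewrite -polyline_rev last_phi; apply: fl; split; last first.
  by rewrite -[X in last X _]last_phi last_rev_belast /phi subr0.
rewrite -[X in path _ X _]last_phi rev_path.
by apply: (homo_path (f := phi)) s01 => u v uv /=; rewrite /phi ltrD2l ltrN2.
Qed.

Lemma length_le_cat f a b c l1 l2 : a <= c <= b ->
  length_le f a c l1 -> length_le f c b l2 -> length_le f a b (l1 + l2).
Proof.
move=> acb f1 f2 s abs.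
have [s1 [s2 [p1 p2 le]]] := itv_partition_split f acb abs.
by apply: le_trans le _; rewrite lerD ?f1 ?f2.
Qed.

End polyline.

(** * Lipschitz curves and their subdivision *)

Section lipschitz_curves.
Context {R : realType} {n : nat}.
Implicit Types (f : R -> 'rV[R]_n) (a b c k l r s t : R).

(** An explicit constant is needed to estimate lengths and to glue curves. *)
Definition lipschitz_with k f a b :=
  forall s t, a <= s <= b -> a <= t <= b -> `|f s - f t| <= k * `|s - t|.

Lemma lipschitz_itvP f a b : [lipschitz f t | t in `[a, b]] <->
  exists2 k, 0 <= k & lipschitz_with k f a b.
Proof.
split.
  move=> /pinfty_ex_gt0[k k_gt0 fk]; exists k; first exact: ltW.
  by move=> s t sab tab; apply: (fk (s, t)); split; rewrite /= in_itv.
move=> [k k_ge0 fk]; exists k; split; first exact: num_real.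
move=> M kM [s t] [/=]; rewrite !in_itv /= => sab tab.
by apply: le_trans (fk s t sab tab) _; rewrite ler_wpM2r// ltW.
Qed.

Lemma lipschitz_with_affine k f a b p m c e :
  a <= p + m * c <= b -> a <= p + m * e <= b ->
  lipschitz_with k f a b ->
  lipschitz_with (k * `|m|) (fun t => f (p + m * t)) c e.
Proof.
move=> cab eab fk s t sce tce.
have inab r : c <= r <= e -> a <= p + m * r <= b.
  move=> /andP[cr re]; have [m_ge0|/ltW m_le0] := leP 0 m.
    have : m * c <= m * r by rewrite ler_wpM2l.
    have : m * r <= m * e by rewrite ler_wpM2l.
    lra.
  have : m * r <= m * c by rewrite ler_wnM2l.
  have : m * e <= m * r by rewrite ler_wnM2l.
  lra.
apply: le_trans (fk _ _ (inab s sce) (inab t tce)) _.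
have -> : p + m * s - (p + m * t) = m * (s - t) by ring.
by rewrite normrM mulrA.
Qed.

Lemma lipschitz_with_eq k f g a b : (forall t, a <= t <= b -> f t = g t) ->
  lipschitz_with k f a b -> lipschitz_with k g a b.
Proof. by move=> fg fk s t sab tab; rewrite -!fg//; exact: fk. Qed.

Lemma lipschitz_with_cat k1 k2 f a b c : a <= c <= b -> 0 <= k1 -> 0 <= k2 ->
  lipschitz_with k1 f a c -> lipschitz_with k2 f c b ->
  lipschitz_with (k1 + k2) f a b.
Proof.
move=> /andP[ac cb] k1_ge0 k2_ge0 f1 f2.
have main s t : a <= s -> s <= t -> t <= b -> `|f s - f t| <= (k1 + k2) * `|s - t|.
  move=> sa st tb; have [tc|ct] := leP t c.
    apply: le_trans (f1 _ _ _ _) _; rewrite ?sa ?(le_trans st)//.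
      by rewrite tc (le_trans sa).
    by rewrite ler_wpM2r// lerDl.
  have [cs|sc] := leP c s.
    apply: le_trans (f2 _ _ _ _) _; rewrite ?cs ?tb ?(le_trans st)//.
      by rewrite (ltW ct).
    by rewrite ler_wpM2r// lerDr.
  apply: le_trans (ler_distD (f c) _ _) _.
  have h1 : `|f s - f c| <= k1 * `|s - c| by apply: f1; rewrite ?sa ?ac ?(ltW sc) ?lexx.
  have h2 : `|f c - f t| <= k2 * `|c - t| by apply: f2; rewrite ?tb ?cb ?(ltW ct) ?lexx.
  apply: le_trans (lerD h1 h2) _; rewrite mulrDl lerD// ler_wpM2l//.
    by rewrite !ler0_norm ?subr_le0 ?(ltW sc)//; lra.
  by rewrite !ler0_norm ?subr_le0 ?(ltW ct)//; lra.
move=> s t /andP[sa sb] /andP[ta tb]; have [st|/ltW ts] := leP s t.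
  exact: main.
by rewrite distrC [X in _ * X]distrC; exact: main.
Qed.

Lemma length_le_lipschitz k f a b : lipschitz_with k f a b ->
  length_le f a b (Num.sqrt n%:R * k * (b - a)).
Proof.
move=> fk s; elim: s a fk => [|c s IH] a fk.
  by move=> /itv_partition_nil ->; rewrite subrr mulr0.
move=> acs; have cs := itv_partition_cons acs.
have ac : a < c by have := acs.1 => /= /andP[].
have cb := itv_partition_le cs.
have fk' : lipschitz_with k f c b.
  by move=> u v /andP[cu ub] /andP[cv vb]; apply: fk;
    rewrite ?ub ?vb ?(le_trans (ltW ac)).
have -> : Num.sqrt n%:R * k * (b - a) =
  Num.sqrt n%:R * (k * (c - a)) + Num.sqrt n%:R * k * (b - c) by ring.
rewrite /= lerD ?IH//; apply: le_trans (euclidean_norm_le_norm _) _.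
rewrite ler_wpM2l ?sqrtr_ge0//; apply: le_trans (fk _ _ _ _) _.
- by rewrite (ltW ac) cb.
- by rewrite lexx (le_trans (ltW ac)).
- by rewrite gtr0_norm ?subr_gt0.
Qed.

Lemma first_failure (P : nat -> Prop) N : P 0 -> ~ P N ->
  exists i, [/\ (i < N)%N, P i & ~ P i.+1].
Proof.
elim: N => [//|N IH] P0 PN1.
have [PN|PN] := pselect (P N); first by exists N.
by have [i [iN Pi Pi1]] := IH P0 PN; exists i; rewrite (ltn_trans iN).
Qed.

(** Subdivide [[0, 1]] so finely that each piece has length at most [eta], and
    stop at the last node [c] before the length exceeds [r]. A partition of
    the next initial segment with polygonal length above [r] spends more than
    [r - eta] up to [c]; concatenating it with any partition of [[c, 1]] shows
    that at most [l - r + eta] is left. *)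
Lemma length_le_cut k f l r eta : 0 <= k -> lipschitz_with k f 0 1 ->
  length_le f 0 1 l -> 0 <= r -> 0 < eta ->
  length_le f 0 1 r \/
  exists c, [/\ 0 <= c < 1, length_le f 0 c r & length_le f c 1 (l - r + eta)].
Proof.
move=> k_ge0 fk fl r_ge0 eta_gt0.
have [fr|fr] := pselect (length_le f 0 1 r); [by left|right].
pose C := Num.sqrt n%:R * k.
have C_ge0 : 0 <= C by rewrite mulr_ge0// sqrtr_ge0.
pose N := (Num.truncn (C / eta)).+1.
have N_gt0 : 0 < N%:R :> R by rewrite ltr0n.
have C_N : C / N%:R <= eta.
  by rewrite ler_pdivrMr// mulrC -ler_pdivrMr// ltW// truncnS_gt.
have [||i [iN fi fi1]] := @first_failure (fun i => length_le f 0 (i%:R / N%:R) r) N.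
- by rewrite mul0r => s /itv_partitionxx ->.
- by rewrite divff// gt_eqF.
set c := _ / _ in fi; set c' := _ / _ in fi1.
have c'E : c' = c + N%:R^-1 by rewrite /c' -natr1 mulrDl mul1r.
have c_ge0 : 0 <= c by rewrite divr_ge0.
have c_lt1 : c < 1 by rewrite ltr_pdivrMr// mul1r ltr_nat.
have c'_le1 : c' <= 1 by rewrite ler_pdivrMr// mul1r ler_nat.
have cc' : c <= c' by rewrite c'E lerDl invr_ge0 ltW.
exists c; split; [by rewrite c_ge0|exact: fi|].
have /existsNP[s /not_implyP[sc' /negP]] := fi1.
rewrite -ltNge => rs t tc.
have [|s1 [s2 [s1c s2c s12]]] :=
  @itv_partition_split R n f 0 c' c s _ sc'.
  by rewrite c_ge0; exact: cc'.
have fk' : lipschitz_with k f c c'.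
  by move=> u v /andP[cu ub] /andP[cv vb]; apply: fk;
    rewrite ?(le_trans _ c'_le1)// andbT (le_trans c_ge0).
have : polyline f c s2 <= eta.
  apply: le_trans C_N; apply: le_trans (length_le_lipschitz fk' s2c) _.
  by rewrite c'E addrAC subrr add0r.
have := fl _ (itv_partition_cat s1c tc).
by rewrite polyline_cat (eqP s1c.2); lra.
Qed.

End lipschitz_curves.

(** * The path distance is a length metric *)

Section path_distance.
Context {R : realType} {n : nat}.
Variable Omega : set 'rV[R]_n.
Implicit Types (x y z : 'rV[R]_n) (f : R -> 'rV[R]_n) (k l : R).

Lemma admissible_pathP x y f : admissible_path Omega x y f <->
  [/\ exists2 k, 0 <= k & lipschitz_with k f 0 1,
      forall t, 0 <= t <= 1 -> closure Omega (f t), f 0 = x & f 1 = y].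
Proof.
split=> -[/lipschitz_itvP flip fO fx fy]; split=> //.
  by move=> t t01; apply: fO; exists t => //=; rewrite in_itv.
by move=> _ [t /= t01 <-]; apply: fO; rewrite in_itv in t01.
Qed.

Lemma epath_dist_le x y f l : admissible_path Omega x y f ->
  length_le f 0 1 l -> (epath_dist Omega x y <= l%:E)%E.
Proof.
move=> fxy /curve_length_le; apply: le_trans.
by apply: ereal_inf_lbound; exists f.
Qed.

Lemma euclidean_norm_le_epath_dist x y :
  ((euclidean_norm (x - y))%:E <= epath_dist Omega x y)%E.
Proof.
apply: le_ereal_inf_tmp => _ [f [_ _ <- <-] <-].
apply: ereal_sup_ubound; exists [:: 1]; first exact: itv_partition1.
by rewrite polylineE /= addr0 euclidean_distC.
Qed.

Hypothesis Omega_diam : (path_diam Omega < +oo)%E.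

Lemma path_distK x y : closure Omega x -> closure Omega y ->
  (path_dist Omega x y)%:E = epath_dist Omega x y.
Proof.
move=> Ox Oy; rewrite /path_dist fineK// fin_numE; apply/andP; split.
  apply/eqP => h; have := euclidean_norm_le_epath_dist x y.
  by rewrite h leeNy_eq.
rewrite -ltey; apply: le_lt_trans Omega_diam.
by apply: ereal_sup_ubound; exists (x, y).
Qed.

Lemma euclidean_norm_le_path_dist x y : closure Omega x -> closure Omega y ->
  euclidean_norm (x - y) <= path_dist Omega x y.
Proof.
by move=> Ox Oy; rewrite -lee_fin path_distK//; exact: euclidean_norm_le_epath_dist.
Qed.

Lemma path_dist_ge0 x y : closure Omega x -> closure Omega y ->
  0 <= path_dist Omega x y.
Proof.
move=> Ox Oy; apply: le_trans (euclidean_norm_le_path_dist Ox Oy).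
exact: euclidean_norm_ge0.
Qed.

Lemma path_dist_near x y e : closure Omega x -> closure Omega y -> 0 < e ->
  exists2 f, admissible_path Omega x y f & length_le f 0 1 (path_dist Omega x y + e).
Proof.
move=> Ox Oy e_gt0.
have : (epath_dist Omega x y < (path_dist Omega x y + e)%:E)%E.
  by rewrite -path_distK// lte_fin ltrDl.
move=> /ereal_inf_lt[_ [f fxy <-] /ltW /curve_length_le fl].
by exists f.
Qed.

(** Curves parametrized by any interval bound the distance, so that pieces of
    curves and glued curves need no reparametrization. *)
Lemma path_dist_le_length f k a b l : a < b -> 0 <= k ->
  lipschitz_with k f a b -> (forall t, a <= t <= b -> closure Omega (f t)) ->
  length_le f a b l -> path_dist Omega (f a) (f b) <= l.
Proof.
move=> ab k_ge0 fk fO fl; have ba_gt0 : 0 < b - a by rewrite subr_gt0.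
have ab_le := ltW ab.
rewrite -lee_fin path_distK; [|by apply: fO; rewrite lexx ?ab_le..].
have E0 : a + (b - a) * 0 = a by rewrite mulr0 addr0.
have E1 : a + (b - a) * 1 = b by rewrite mulr1 subrKC.
apply: (@epath_dist_le _ _ (fun t => f (a + (b - a) * t))); last first.
  by apply: length_le_affine; rewrite ?E0 ?E1.
apply/admissible_pathP; split; rewrite ?E0 ?E1//.
  exists (k * `|b - a|); first by rewrite mulr_ge0.
  by apply: lipschitz_with_affine fk; rewrite ?E0 ?E1 ?lexx ?ab_le.
move=> t /andP[t_ge0 t_le1]; apply: fO; rewrite lerDl mulr_ge0 ?(ltW ba_gt0)//=.
by rewrite -lerBrDl ler_piMr// ltW.
Qed.

Lemma path_dist_sym_le x y : closure Omega x -> closure Omega y ->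
  path_dist Omega y x <= path_dist Omega x y.
Proof.
move=> Ox Oy; apply/ler_addgt0Pr => e e_gt0.
have [f /admissible_pathP[[k k_ge0 fk] fO fx fy] fl] := path_dist_near Ox Oy e_gt0.
have -> : y = f (1 - 0) by rewrite subr0.
have -> : x = f (1 - 1) by rewrite subrr.
apply: (@path_dist_le_length (fun t => f (1 - t)) (k * `|-1|)) => //.
- by rewrite mulr_ge0.
- apply: (@lipschitz_with_eq _ _ _ (fun t => f (1 + (-1) * t))) => [t _|].
    by rewrite mulN1r.
  by apply: lipschitz_with_affine fk; lra.
- by move=> t t01; apply: fO; lra.
- by apply: length_le_rev; rewrite subr0 subrr fx fy.
Qed.

(** The two curves are glued on [[0, 2]], the second one shifted by [1]. *)
Lemma path_dist_triangle x y z :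
  closure Omega x -> closure Omega y -> closure Omega z ->
  path_dist Omega x z <= path_dist Omega x y + path_dist Omega y z.
Proof.
move=> Ox Oy Oz; apply/ler_addgt0Pr => e e_gt0.
have e2 : 0 < e / 2 by rewrite divr_gt0.
have [f1 /admissible_pathP[[k1 k1_ge0 lip1] O1 f1x f1y] l1] :=
  path_dist_near Ox Oy e2.
have [f2 /admissible_pathP[[k2 k2_ge0 lip2] O2 f2y f2z] l2] :=
  path_dist_near Oy Oz e2.
pose f t := if t <= 1 then f1 t else f2 (-1 + 1 * t).
have fE1 t : 0 <= t <= 1 -> f1 t = f t by rewrite /f => /andP[_ ->].
have fE2 t : 1 <= t <= 2 -> f2 (-1 + 1 * t) = f t.
  rewrite /f => /andP[t1 _]; case: ifP => // t1'.
  have -> : t = 1 by apply/eqP; rewrite eq_le t1 t1'.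
  by rewrite mulr1 addNr f2y f1y.
have -> : x = f 0 by rewrite -fE1// lexx ler01.
have -> : z = f 2 by rewrite -fE2 ?lexx ?ler1n// -f2z; congr f2; ring.
have -> : path_dist Omega (f 0) y + path_dist Omega y (f 2) + e =
  (path_dist Omega x y + e / 2) + (path_dist Omega y z + e / 2).
  have -> : f 0 = x by rewrite -fE1// lexx ler01.
  have -> : f 2 = z by rewrite -fE2 ?lexx ?ler1n// -f2z; congr f2; ring.
  by field.
apply: (@path_dist_le_length f (k1 + k2 * `|1|)) => //.
- by rewrite addr_ge0// mulr_ge0.
- apply: (@lipschitz_with_cat _ _ _ _ _ 0 2 1); rewrite ?mulr_ge0//; first by lra.
    exact: lipschitz_with_eq fE1 lip1.
  by apply: lipschitz_with_eq fE2 _; apply: lipschitz_with_affine lip2; lra.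
- move=> t /andP[t0 t2]; have [t1|/ltW t1] := leP t 1.
    by rewrite -fE1 ?t0//; apply: O1; rewrite t0.
  by rewrite -fE2 ?t1//; apply: O2; lra.
- apply: (@length_le_cat _ _ _ 0 2 1); first by lra.
    exact: length_le_eq fE1 l1.
  apply: length_le_eq fE2 _; apply: length_le_affine => //.
  have -> : -1 + 1 * 1 = 0 :> R by ring.
  by have -> : -1 + 1 * 2 = 1 :> R by ring.
Qed.

Lemma path_distxx x : closure Omega x -> path_dist Omega x x = 0.
Proof.
move=> Ox; apply/eqP; rewrite eq_le path_dist_ge0// andbT.
have := @path_dist_le_length (fun=> x) 0 0 1 0; apply=> // [s t _ _|s _].
  by rewrite subrr normr0 mul0r.
suff -> : polyline (fun=> x) 0 s = 0 by [].
by elim: s {1}(0 : R) => //= c s IH a; rewrite subrr euclidean_norm0 add0r.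
Qed.

Lemma path_dist_split x y r eta : closure Omega x -> closure Omega y ->
  0 <= r <= path_dist Omega x y -> 0 < eta ->
  exists z, [/\ closure Omega z, path_dist Omega x z <= r &
    path_dist Omega z y <= path_dist Omega x y - r + eta].
Proof.
move=> Ox Oy /andP[r_ge0 r_le] eta_gt0.
have eta2 : 0 < eta / 2 by rewrite divr_gt0.
have [f /admissible_pathP[[k k_ge0 fk] fO fx fy] fl] := path_dist_near Ox Oy eta2.
have [fr|[c [/andP[c_ge0 c_lt1] f0c fc1]]] := length_le_cut k_ge0 fk fl r_ge0 eta2.
  exists y; split=> //; last by rewrite path_distxx//; lra.
  by rewrite -fx -fy; exact: path_dist_le_length fk fO fr.
have c_in t : 0 <= t <= c \/ c <= t <= 1 -> 0 <= t <= 1 by case; lra.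
exists (f c); split.
- by apply: fO; rewrite c_ge0 ltW.
- have [c0|c_neq0] := eqVneq c 0; first by rewrite c0 fx path_distxx.
  rewrite -fx; apply: (path_dist_le_length _ k_ge0 _ _ f0c).
  + by rewrite lt_neqAle eq_sym c_neq0.
  + by move=> s t sc tc; apply: fk; apply: c_in; left.
  + by move=> t tc; apply: fO; apply: c_in; left.
- rewrite -{1}fy; apply: (@le_trans _ _ (path_dist Omega x y + eta / 2 - r + eta / 2)).
    apply: (path_dist_le_length c_lt1 k_ge0 _ _ fc1).
    + by move=> s t sc tc; apply: fk; apply: c_in; right.
    + by move=> t tc; apply: fO; apply: c_in; right.
  lra.
Qed.

Lemma path_dist_length_space : length_space (closure Omega) (path_dist Omega).
Proof.
split.
- exact: path_distxx.
- exact: path_dist_ge0.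
- by move=> x y Ox Oy; apply/eqP; rewrite eq_le !path_dist_sym_le.
- exact: path_dist_triangle.
- exact: path_dist_split.
Qed.

(** * Solutions of the equation *)

Hypothesis Omega_open : open Omega.

(** The distance dominates the sup norm, and a sup-norm ball around [x] stays
    in [Omega]. *)
Lemma path_dist_boundary_gt0 x : Omega x ->
  exists2 c, 0 < c & forall y, closure Omega y -> ~ Omega y -> c <= path_dist Omega x y.
Proof.
move=> Ox; have /nbhs_ballP[c /= c_gt0 cO] : nbhs x Omega by exact: open_nbhs_nbhs.
exists c => // y cy Oy; have cx := subset_closure Ox.
apply: le_trans (euclidean_norm_le_path_dist cx cy).
apply: le_trans (norm_le_euclidean_norm _).
by rewrite leNgt; apply/negP => xy; apply/Oy/cO; rewrite -ball_normE.
Qed.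

(** [rho] is bounded below on the ball by the smaller of [eps] and the distance
    to the boundary, so the quotients of the bounded function [u] are bounded
    and the real suprema of [slope_up] and [slope_down] are genuine. *)
Lemma solution_common_slope (eps : R) (u : 'rV[R]_n -> R) (B : R) : 0 < eps ->
  (forall x, closure Omega x -> `|u x| <= B) ->
  (forall x, Omega x -> - infinity_laplacian Omega eps u x = 0) ->
  common_slope (closure Omega) Omega (path_dist Omega) eps u
    (slope_up Omega eps u).
Proof.
move=> eps_gt0 uB u_eq.
have up_down x : Omega x -> slope_up Omega eps u x = slope_down Omega eps u x.
  move=> /u_eq /eqP; rewrite oppr_eq0 mulf_eq0 invr_eq0 gt_eqF//= subr_eq0.
  by move/eqP.
have rhoE x y : Omega x -> path_ball Omega x eps y ->
    rho Omega eps x y = tug_step Omega (path_dist Omega) eps x y.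
  move=> Ox [_ xy]; rewrite /rho /tug_step mem_set//=.
  by case: ifP => // _; apply/max_idPr.
have step_ge x : Omega x -> exists2 c, 0 < c &
    forall y, path_ball Omega x eps y -> c <= rho Omega eps x y.
  move=> Ox; have [c c_gt0 cb] := path_dist_boundary_gt0 Ox.
  exists (Num.min c eps); first by rewrite lt_min c_gt0.
  move=> y xy; rewrite rhoE// /tug_step; case: ifPn => [_|].
    by rewrite ge_min lexx orbT.
  move=> /negP; rewrite inE => Oy.
  by rewrite ge_min cb//; exact: xy.1.
have quotient_sup (F : 'rV[R]_n -> R) x : Omega x ->
    (forall y, closure Omega y -> F y <= B + B) ->
    has_sup [set F y / rho Omega eps x y | y in path_ball Omega x eps].
  move=> Ox FB; have cx := subset_closure Ox.
  split; first by exists (F x / rho Omega eps x x), x => //; split=> //;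
    rewrite path_distxx// ltW.
  have [c c_gt0 cr] := step_ge x Ox; exists ((B + B) / c) => _ [y xy <-].
  have r_gt0 : 0 < rho Omega eps x y by exact: lt_le_trans (cr _ xy).
  have B_ge0 : 0 <= B by exact: le_trans (uB x cx).
  rewrite ler_pdivrMr//; apply: le_trans (FB y xy.1) _.
  rewrite -mulrA ler_peMr ?addr_ge0// mulrC ler_pdivlMr// mul1r; exact: cr.
have bound x y : closure Omega x -> closure Omega y -> u y - u x <= B + B.
  by move=> /uB + /uB; rewrite !ler_norml; lra.
have up_sup x (Ox : Omega x) := quotient_sup _ x Ox
  (fun y => bound x y (subset_closure Ox)).
have down_sup x (Ox : Omega x) := quotient_sup _ x Ox
  (fun y cy => bound y x cy (subset_closure Ox)).
have r_gt0 x y : Omega x -> path_ball Omega x eps y -> 0 < rho Omega eps x y.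
  by move=> Ox xy; have [c c_gt0 /(_ _ xy)] := step_ge x Ox; exact: lt_le_trans.
split.
- move=> x y Ox cy xy; have bxy : path_ball Omega x eps y by [].
  rewrite -rhoE// ler_norml -[X in X && _]lerNl opprB.
  rewrite -!ler_pdivrMr ?r_gt0//; apply/andP; split.
    by rewrite up_down//; apply: ub_le_sup; [exact: (down_sup _ Ox).2|exists y].
  by apply: ub_le_sup; [exact: (up_sup _ Ox).2|exists y].
- move=> x L Ox LS; have [_ [y xy <-]] := sup_gt (up_sup _ Ox).1 LS.
  by rewrite ltr_pdivlMr ?r_gt0// rhoE// => h; exists y; case: xy.
- move=> x L Ox; rewrite up_down// => LS.
  have [_ [y xy <-]] := sup_gt (down_sup _ Ox).1 LS.
  by rewrite ltr_pdivlMr ?r_gt0// rhoE// => h; exists y; case: xy.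
Qed.

End path_distance.

Theorem proposition3p11 (R : realType) (n : nat) (n_gt0 : (0 < n)%N)
    (Omega : set 'rV[R]_n)
    (Omega_bounded : bounded_set Omega)
    (Omega_connected : connected Omega)
    (Omega_open : open Omega)
    (Omega_diam : (path_diam Omega < +oo)%E)
    (eps : R) (eps_gt0 : 0 < eps) (eps_lt1 : eps < 1)
    (g : 'rV[R]_n -> R) (g_cont : {within boundary Omega, continuous g})
    (K : R) (K_ge0 : 0 <= K)
    (g_lip : path_lipschitz Omega (boundary Omega) K g)
    (u : 'rV[R]_n -> R) (u_sol : bounded_solution Omega eps g u) :
  path_lipschitz Omega (closure Omega) K u.
Proof.
have [/pinfty_ex_gt0[B _ uB] u_eq ug] := u_sol.
have bdry x : closure Omega x -> ~ Omega x -> boundary Omega x.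
  by move=> cx Ox; split=> //; rewrite (interior_id _).1.
have uS := solution_common_slope Omega_diam Omega_open eps_gt0 uB u_eq.
apply: (common_slope_lipschitz (path_dist_length_space Omega_diam)
  (@subset_closure _ Omega) eps_gt0 _ K_ge0 uS uB).
  move=> x y Ox cy Oy.
  have [c c_gt0 cb] := path_dist_boundary_gt0 Omega_diam Omega_open Ox.
  exact: lt_le_trans (cb y cy Oy).
by move=> x y cx Ox cy Oy; rewrite !ug; [apply: g_lip|..]; exact: bdry.
Qed.
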